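(* Let $R$ be a commutative ring and $n \geq 2$ an integer. As $l \to \infty$, whenever the smallest number of generators of the $R$-algebra $M_n(R)^l$ increases, the increment is exactly $1$; that is, if $r_{l,n}(R)$ denotes the smallest number of generators of the $R$-algebra $M_n(R)^l$ and $r_{l,n}(R) < r_{l+1,n}(R)$, then $r_{l+1,n}(R) - r_{l,n}(R) = 1$. Furthermore, for any $m,n \geq 2$, $$\mathrm{gen}_{m+1,n}(R) \geq 2 \, \mathrm{gen}_{m,n}(R).$$
   Context: All rings are associative with a two-sided identity. $M_n(R)$ is the $R$-algebra of $n\times n$ matrices over $R$, and $M_n(R)^k$ is the direct sum of $k$ copies of it with componentwise operations. A set $S$ generates an $R$-algebra $A$ if every element of $A$ is an $R$-linear combination of nonempty products of elements of $S$ (the identity element is not automatically included). An algebra ''has (admits) $m$ generators'' if it can be generated by $m$ elements. $\mathrm{gen}_{m,n}(R)$ is the integer such that the $R$-algebra $M_n(R)^{\mathrm{gen}_{m,n}(R)}$ admits $m$ generators, while $M_n(R)^{1+\mathrm{gen}_{m,n}(R)}$ needs at least $m+1$ generators; if every $R$-algebra $M_n(R)^k$ admits at most $m$ generators, then $\mathrm{gen}_{m,n}(R)=\infty$. *)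

(* Defs.v *)
From mathcomp Require Import all_boot all_order all_algebra.
From mathcomp Require Import boolp classical_sets constructive_ereal.

Set Implicit Arguments.
Unset Strict Implicit.
Unset Printing Implicit Defensive.

Import GRing.Theory.
Local Open Scope classical_set_scope.
Local Open Scope ring_scope.

(* M_n(R)^k; the structures on finite functions are the componentwise ones,
   and the ring product on 'M[R]_n is *m. *)
Notation mxpow R n k := {ffun 'I_k -> 'M[R]_n}.

(* The unit is not automatically included, hence the nonempty words. This is
   stated for M_n(R)^k rather than for a general R-algebra because lalgType
   excludes the zero algebra, which occurs here when R is the zero ring or
   when k = 0. *)
Definition generates (R : comPzRingType) (n k : nat)
    (S : set (mxpow R n k)) : Prop :=
  forall a : mxpow R n k, exists ws : seq (R * seq (mxpow R n k)),
    (forall w, w \in ws -> w.2 != [::] /\ (forall x, x \in w.2 -> S x)) /\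
    a = \sum_(w <- ws) w.1 *: \prod_(x <- w.2) x.

(* The m elements need not be distinct: an algebra admitting m generators also
   admits m + 1 generators, even if it is finite and small. *)
Definition admits_generators (R : comPzRingType) (n k m : nat) : Prop :=
  exists t : m.-tuple (mxpow R n k), generates [set` t].

Definition needs_at_least (R : comPzRingType) (n k m : nat) : Prop :=
  forall j : nat, admits_generators R n k j -> (m <= j)%N.

Definition is_smallest_number_of_generators (R : comPzRingType) (n k m : nat) :
    Prop :=
  admits_generators R n k m /\ needs_at_least R n k m.

(* r_{l,n}(R); such a number always exists, see rnumP. *)
Definition rnum (R : comPzRingType) (l n : nat) : nat :=
  xget 0%N [set m | is_smallest_number_of_generators R n l m].

Definition is_gen (R : comPzRingType) (m n : nat) (g : \bar int) : Prop :=
  (exists k : nat, [/\ g = (k%:Z)%:E, admits_generators R n k m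
                     & needs_at_least R n k.+1 m.+1])
  \/ (g = +oo%E /\ forall k : nat, admits_generators R n k m).

(* gen_{m,n}(R), a natural number or +oo; see genP and is_gen_unique. *)
Definition gen (R : comPzRingType) (m n : nat) : \bar int :=
  xget +oo%E [set g | is_gen R m n g].

Lemma generatesS (R : comPzRingType) (n k : nat) (S S' : set (mxpow R n k)) :
  S `<=` S' -> generates S -> generates S'.
Proof.
move=> SS' gS a; have [ws [wsP ->]] := gS a.
exists ws; split=> // w /wsP [w0 wS]; split=> // x /wS; exact: SS'.
Qed.

Definition mxpow_delta (R : comPzRingType) (n k : nat)
    (p : 'I_k * ('I_n * 'I_n)) : mxpow R n k :=
  [ffun c => if c == p.1 then delta_mx p.2.1 p.2.2 else 0].

Lemma admits_generators_fin (R : comPzRingType) (n k : nat) :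
  exists m, admits_generators R n k m.
Proof.
pose s := [seq @mxpow_delta R n k p | p <- index_enum ('I_k * ('I_n * 'I_n))%type].
exists (size s), (in_tuple s) => a.
exists [seq (a p.1 p.2.1 p.2.2, [:: @mxpow_delta R n k p])
       | p <- index_enum ('I_k * ('I_n * 'I_n))%type]; split.
  move=> w /mapP [p _ ->] /=; split=> // x; rewrite inE => /eqP -> /=.
  by apply: map_f; rewrite mem_index_enum.
rewrite big_map /=; apply/ffunP => c; apply/matrixP => i j.
rewrite sum_ffunE summxE (bigD1 (c, (i, j))) //= big_seq1 !ffunE eqxx.
rewrite !mxE !eqxx /= mulr1 big1 ?addr0 // => -[c' [i' j']] /= ne.
rewrite big_seq1 !ffunE /=; case: eqP => [e|_]; last by rewrite !mxE mulr0.
rewrite !mxE; case: eqP => [ei|_]; last by rewrite mulr0.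
case: eqP => [ej|_]; last by rewrite mulr0.
by rewrite e ei ej eqxx in ne.
Qed.

Lemma admits_generatorsS (R : comPzRingType) (n k m m' : nat) :
  (m <= m')%N -> admits_generators R n k m -> admits_generators R n k m'.
Proof.
move=> mm' [t gt]; have sz : size (t ++ nseq (m' - m) 0) == m'.
  by rewrite size_cat size_nseq size_tuple subnKC.
exists (Tuple sz); apply: generatesS gt => x /= xt.
by rewrite mem_cat xt.
Qed.

(* Projection onto the first k components. *)
Lemma admits_generators_proj (R : comPzRingType) (n k k' m : nat) :
  (k <= k')%N -> admits_generators R n k' m -> admits_generators R n k m.
Proof.
move=> kk' [t gt].
pose f (a : mxpow R n k') : mxpow R n k := [ffun c => a (widen_ord kk' c)].
pose h (b : mxpow R n k) : mxpow R n k' :=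
  [ffun c : 'I_k' => oapp b 0 (insub (nat_of_ord c))].
have fprod (w : seq (mxpow R n k')) :
    f (\prod_(x <- w) x) = \prod_(x <- map f w) x.
  rewrite big_map; elim: w => [|x w IH]; first by
    rewrite !big_nil; apply/ffunP => c; rewrite !ffunE.
  by rewrite !big_cons -IH; apply/ffunP => c; rewrite !ffunE.
exists (map_tuple f t) => b; have [ws [wsP hb]] := gt (h b).
exists [seq (w.1, map f w.2) | w <- ws]; split.
  move=> _ /mapP [w /wsP [w0 wt] ->] /=; split; first by case: (w.2) w0.
  by move=> _ /mapP [x /wt xt ->]; apply: map_f.
have -> : b = f (h b).
  apply/ffunP => c; rewrite !ffunE /=.
  by case: insubP => [c' _ /val_inj ->|] //=; rewrite ltn_ord.
rewrite hb big_map /=; apply/ffunP => c; rewrite ffunE !sum_ffunE.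
by apply: eq_bigr => w _; rewrite -fprod !ffunE.
Qed.

Lemma rnumP (R : comPzRingType) (l n : nat) :
  is_smallest_number_of_generators R n l (rnum R l n).
Proof.
have ex : exists m, `[< admits_generators R n l m >].
  by have [m mP] := admits_generators_fin R n l; exists m; apply/asboolP.
case: (ex_minnP ex) => m /asboolP gm min.
apply: (@xgetPex _ 0%N [set m | is_smallest_number_of_generators R n l m]).
by exists m; split=> // j /asboolP; apply: min.
Qed.

Lemma genP (R : comPzRingType) (m n : nat) : is_gen R m n (gen R m n).
Proof.
apply: (@xgetPex _ +oo%E [set g | is_gen R m n g]).
have [all|/existsNP ex] := pselect (forall k, admits_generators R n k m).
  by exists +oo%E; right.
have ex' : exists k, `[< ~ admits_generators R n k m >].
  by have [k kP] := ex; exists k; apply/asboolP.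
case: (ex_minnP ex') => -[|k] /asboolP nk min.
  case: nk; apply: (@admits_generatorsS R n 0 0) => //.
  exists [tuple] => a; exists [::]; split=> //.
  by apply/ffunP => -[].
exists (k%:Z)%:E; left; exists k; split=> //.
  apply: contrapT => /asboolP /min; by rewrite ltnn.
move=> j gj; rewrite ltnNge; apply/negP => jm.
by apply: nk; apply: admits_generatorsS gj.
Qed.

Lemma is_gen_unique (R : comPzRingType) (m n : nat) (g g' : \bar int) :
  is_gen R m n g -> is_gen R m n g' -> g = g'.
Proof.
have le k k' : needs_at_least R n k.+1 m.+1 -> admits_generators R n k' m ->
    (k' <= k)%N.
  move=> nk ak; rewrite leqNgt; apply/negP => kk'.
  by have := nk _ (admits_generators_proj kk' ak); rewrite ltnn.
case=> [[k [-> ak nk]]|[-> al]]; case=> [[k' [-> ak' nk']]|[-> al']] //.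
- by congr (_%:Z%:E); apply/eqP; rewrite eqn_leq (le k' k) // (le k k').
- by have := le _ _ nk (al' k.+1); rewrite ltnn.
- by have := le _ _ nk' (al k'.+1); rewrite ltnn.
Qed.

(* Main.v *)
Require Import Defs.
From mathcomp Require Import all_boot all_order all_algebra.
From mathcomp Require Import boolp classical_sets constructive_ereal.

(** One further generator doubles the number of copies. Put [A = M_n(R)^k] and
    identify [M_n(R)^(k + k)] with [A * A]. If [a_1, ..., a_m] generate [A],
    then the diagonal elements [(a_i, a_i)] generate the diagonal copy of [A],
    and multiplying it by the idempotent [e = (1, 0)] gives [A * 0]. Since
    [(a, b) = (b, b) + e (a - b, a - b)], the [m + 1] elements
    [e, (a_1, a_1), ..., (a_m, a_m)] generate [A * A]. This is
    [admits_generators_double].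

    Both assertions follow. For [l >= 1] we have [l + 1 <= l + l], and projecting
    onto the first [l + 1] components shows that [M_n(R)^(l + 1)] needs at most
    one generator more than [M_n(R)^l]. If [gen_{m,n}(R) = k] is finite, then
    [M_n(R)^(2 k)] has [m + 1] generators, whence [2 k <= gen_{m+1,n}(R)]; if it
    is infinite, then so is [gen_{m+1,n}(R)]. *)

Set Implicit Arguments.
Unset Strict Implicit.
Unset Printing Implicit Defensive.

Import GRing.Theory Num.Theory.
Local Open Scope classical_set_scope.
Local Open Scope ring_scope.

Lemma mxpow_scalerAr (R : comPzRingType) (n k : nat) (r : R)
    (a b : mxpow R n k) : r *: (a * b) = a * (r *: b).
Proof. by apply/ffunP => c; rewrite !ffunE; exact: scalemxAr. Qed.

Section Doubling.
Variables (R : comPzRingType) (n k : nat).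

Definition mxpow_pair (a b : mxpow R n k) : mxpow R n (k + k) :=
  [ffun c => match split c with inl i => a i | inr i => b i end].

Definition mxpow_diag (a : mxpow R n k) := mxpow_pair a a.

Lemma mxpow_pairD a b a' b' :
  mxpow_pair a b + mxpow_pair a' b' = mxpow_pair (a + a') (b + b').
Proof. by apply/ffunP => c; rewrite !ffunE; case: split => i; rewrite ffunE. Qed.

Lemma mxpow_pairM a b a' b' :
  mxpow_pair a b * mxpow_pair a' b' = mxpow_pair (a * a') (b * b').
Proof. by apply/ffunP => c; rewrite !ffunE; case: split => i; rewrite ffunE. Qed.

Lemma mxpow_pairZ r a b : r *: mxpow_pair a b = mxpow_pair (r *: a) (r *: b).
Proof. by apply/ffunP => c; rewrite !ffunE; case: split => i; rewrite ffunE. Qed.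

Lemma mxpow_pair_surj (x : mxpow R n (k + k)) : exists a b, x = mxpow_pair a b.
Proof.
exists [ffun i => x (lshift k i)], [ffun i => x (rshift k i)].
by apply/ffunP => c; rewrite ffunE; case: split_ordP => i ->; rewrite ffunE.
Qed.

Lemma mxpow_diag_prod (w : seq (mxpow R n k)) :
  mxpow_diag (\prod_(x <- w) x) = \prod_(x <- map mxpow_diag w) x.
Proof.
elim: w => [|x w IH] /=; last by rewrite !big_cons -IH mxpow_pairM.
by rewrite !big_nil; apply/ffunP => c; rewrite !ffunE; case: split => i; rewrite ffunE.
Qed.

Lemma mxpow_diag_lincomb (ws : seq (R * seq (mxpow R n k))) :
  mxpow_diag (\sum_(w <- ws) w.1 *: \prod_(x <- w.2) x) =
  \sum_(w <- ws) w.1 *: \prod_(x <- map mxpow_diag w.2) x.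
Proof.
elim: ws => [|w ws IH]; last first.
  by rewrite !big_cons -IH -mxpow_diag_prod mxpow_pairZ mxpow_pairD.
by rewrite !big_nil; apply/ffunP => c; rewrite !ffunE; case: split => i; rewrite ffunE.
Qed.

(** The generators are the idempotent [(1, 0)], which separates the two halves,
    and the diagonal images of [m] generators of [M_n(R)^k]. *)
Lemma admits_generators_double m :
  admits_generators R n k m -> admits_generators R n (k + k) m.+1.
Proof.
move=> [t gt]; pose e := mxpow_pair 1 0.
exists (cons_tuple e (map_tuple mxpow_diag t)) => x.
have [a [b ->]] := mxpow_pair_surj x.
have [ws [wsP wsE]] := gt b; have [vs [vsP vsE]] := gt (a - b).
(* The words for b yield (b, b); those for a - b, prefixed by e, yield
   (a - b, 0). *)
exists ([seq (w.1, map mxpow_diag w.2) | w <- ws] ++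
        [seq (v.1, e :: map mxpow_diag v.2) | v <- vs]); split.
  move=> w; rewrite mem_cat => /orP[] /mapP [v vin ->] /=.
    have [v0 vt] := wsP _ vin; split; first by case: (v.2) v0.
    by move=> _ /mapP [y /vt yt ->]; rewrite inE map_f ?orbT.
  have [_ vt] := vsP _ vin; split=> // y; rewrite inE => /orP [/eqP ->|].
    by rewrite inE eqxx.
  by move=> /mapP [z /vt zt ->]; rewrite inE map_f ?orbT.
rewrite big_cat !big_map /= -mxpow_diag_lincomb -wsE.
under [X in _ = _ + X]eq_bigr do rewrite big_cons mxpow_scalerAr.
rewrite -mulr_sumr -mxpow_diag_lincomb -vsE mxpow_pairM mxpow_pairD.
by rewrite mul1r mul0r addr0 addrC subrK.
Qed.

End Doubling.

Lemma rnum_leS (R : comPzRingType) (n l : nat) :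
  (1 <= l)%N -> (rnum R l.+1 n <= (rnum R l n).+1)%N.
Proof.
move=> l1; have [gl _] := rnumP R l n; have [_] := rnumP R l.+1 n; apply.
apply: admits_generators_proj (admits_generators_double gl).
by rewrite -addn1 leq_add2l.
Qed.

Lemma gen_ge (R : comPzRingType) (m n k : nat) :
  admits_generators R n k m -> ((k%:Z)%:E <= gen R m n)%E.
Proof.
move=> gk; case: (genP R m n) => [[g [-> _ needs]]|[-> _]]; last exact: leey.
rewrite lee_fin lez_nat leqNgt; apply/negP => gltk.
by have := needs _ (admits_generators_proj gltk gk); rewrite ltnn.
Qed.

Lemma gen_pinfty (R : comPzRingType) (m n : nat) :
  (forall k, admits_generators R n k m) -> gen R m n = +oo%E.
Proof. by move=> all; apply: is_gen_unique (genP R m n) _; right. Qed.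

Theorem theorem2p8 (R : comPzRingType) (n : nat) (hn : (2 <= n)%N) :
  (forall l : nat, (1 <= l)%N -> (rnum R l n < rnum R l.+1 n)%N ->
     (rnum R l.+1 n - rnum R l n)%N = 1%N) /\
  (forall m : nat, (2 <= m)%N -> (2%:E * gen R m n <= gen R m.+1 n)%E).
Proof.
split=> [l l1 lt|m _].
  have -> : rnum R l.+1 n = (rnum R l n).+1.
    by apply/eqP; rewrite eqn_leq rnum_leS.
  by rewrite subSnn.
case: (genP R m n) => [[k [-> gk _]]|[_ all]].
  rewrite -EFinM mulr_natl mulr2n -PoszD.
  exact: gen_ge (admits_generators_double gk).
rewrite (gen_pinfty (m := m.+1)) ?leey // => k.
exact: admits_generatorsS (leqnSn m) (all k).
Qed.
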